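(* Let $n,k,m$ be integers with $1\le k\le n$ and $1\le m\le n$, and let $B_{n,k}$ be any $k$-regular bipartite graph with bipartition $(X,Y)$ such that $|X|=|Y|=n$. Then $$k(m-2)+2\leq rb(B_{n,k},mK_2)\leq k(m-1)+1.$$
   Context: All graphs are simple and finite. $mK_2$ denotes a matching of size $m$ (that is, $m$ pairwise disjoint edges). An edge-coloring of a graph $G$ with $r$ colors is an arbitrary (not necessarily proper) assignment of colors to the edges of $G$ in which exactly $r$ distinct colors appear. A subgraph of an edge-colored graph is rainbow if no two of its edges have the same color. For a graph $G$ and a subgraph $H$ of $G$, the rainbow number $rb(G,H)$ is the minimum positive integer $r$ such that every edge-coloring of $G$ with $r$ colors contains a rainbow subgraph isomorphic to $H$. Equivalently, $rb(G,H)=f(G,H)+1$, where $f(G,H)$ is the maximum number of colors in an edge-coloring of $G$ with no rainbow copy of $H$ (taken to be $0$ if there is no such coloring). *)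

(* Defs.v *)
From mathcomp Require Import all_boot.

Set Implicit Arguments.
Unset Strict Implicit.
Unset Printing Implicit Defensive.

Record sgraph := SGraph {
  svertex :> finType;
  sedge : rel svertex;
  sedge_sym : symmetric sedge;
  sedge_irr : irreflexive sedge
}.

Definition edges (G : sgraph) : {set {set G}} :=
  [set [set p.1; p.2] | p : G * G & sedge p.1 p.2].

Definition regular (G : sgraph) (k : nat) : bool :=
  [forall x : G, #|[set y | sedge x y]| == k].

Definition bipartition (G : sgraph) (X Y : {set G}) : bool :=
  [&& [disjoint X & Y], X :|: Y == [set: G] &
      [forall x : G, forall y : G, sedge x y ==>
        ((x \in X) && (y \in Y) || (x \in Y) && (y \in X))]].

Definition matching_rel (m : nat) : rel ('I_m * bool) :=
  fun u v => (u.1 == v.1) && (u.2 != v.2).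

Lemma matching_sym (m : nat) : symmetric (@matching_rel m).
Proof. by move=> u v; rewrite /matching_rel eq_sym [v.2 == _]eq_sym. Qed.

Lemma matching_irr (m : nat) : irreflexive (@matching_rel m).
Proof. by move=> u; rewrite /matching_rel !eqxx. Qed.

(* m K_2: the edges are {(i, false), (i, true)} for i < m *)
Definition matching_graph (m : nat) : sgraph :=
  SGraph (@matching_sym m) (@matching_irr m).

(* The subgraphs of G isomorphic to H are the images of such maps: vertex set
   phi(V(H)), edge set copy_edges phi. They need not be induced. *)
Definition embedding (H G : sgraph) (phi : {ffun H -> G}) : bool :=
  injectiveb phi &&
  [forall x : H, forall y : H, sedge x y ==> sedge (phi x) (phi y)].

Definition copy_edges (H G : sgraph) (phi : {ffun H -> G}) : {set {set G}} :=
  [set phi @: (e : {set H}) | e in edges H].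

Section Coloring.
Variables (G : sgraph) (r : nat).

(* Only the values of c on edges G matter. *)
Definition edge_coloring (c : {ffun {set G} -> 'I_r}) : bool :=
  #|c @: edges G| == r.

Definition rainbow (c : {ffun {set G} -> 'I_r}) (F : {set {set G}}) : bool :=
  dinjectiveb c F.

Definition has_rainbow_copy (H : sgraph) (c : {ffun {set G} -> 'I_r}) : bool :=
  [exists phi : {ffun H -> G}, embedding phi && rainbow c (copy_edges phi)].

End Coloring.

Definition forces_rainbow (G H : sgraph) (r : nat) : bool :=
  (0 < r) && [forall c : {ffun {set G} -> 'I_r},
                edge_coloring c ==> has_rainbow_copy H c].

(* With more colors than edges there is no coloring at all. *)
Lemma forces_rainbow_ex (G H : sgraph) : exists r, forces_rainbow G H r.
Proof.
exists #|edges G|.+1; apply/andP; split=> //.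
apply/forallP => c; apply/implyP => /eqP col_c.
by have := leq_imset_card c (mem (edges G)); rewrite col_c ltnn.
Qed.

Definition rb (G H : sgraph) : nat := ex_minn (forces_rainbow_ex G H).

(* Main.v *)
(* Upper bound: choosing one edge of each colour gives k(m-1)+1 edges in a
   bipartite graph of maximum degree at most k; m-1 vertices cover at most
   k(m-1) of them, so by Koenig's theorem they contain a matching of size m.
   Lower bound: give distinct colours to the edges at m-2 vertices of X and one
   further colour to all other edges; a rainbow matching then has at most m-1
   edges. Identifying colours produces every smaller number of colours. *)

Require Import Defs.
From HB Require Import structures.
From mathcomp Require Import all_boot all_order all_algebra.
From mathcomp Require Import zify.
Set Implicit Arguments.
Unset Strict Implicit.
Unset Printing Implicit Defensive.
Import Order.TTheory GRing.Theory Num.Theory.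

(** * Vertex covers and Koenig's theorem for sets of pairs *)

Definition coverable (T U : finType) (E : {set T * U}) (s : nat) : bool :=
  [exists A : {set T}, exists B : {set U},
    (#|A| + #|B| <= s) && [forall p in E, (p.1 \in A) || (p.2 \in B)]].

Lemma coverableP (T U : finType) (E : {set T * U}) s :
  reflect (exists (A : {set T}) (B : {set U}),
             #|A| + #|B| <= s /\ forall p, p \in E -> (p.1 \in A) || (p.2 \in B))
          (coverable E s).
Proof.
apply: (iffP existsP) => -[A].
  by case/existsP=> B /andP[sAB /forall_inP cov]; exists A, B.
case=> B [sAB cov]; exists A; apply/existsP; exists B; rewrite sAB.
exact/forall_inP.
Qed.

Definition swap_set (T U : finType) (E : {set T * U}) : {set U * T} :=
  [set p | (p.2, p.1) \in E].

(** Symmetry of the two sides, so that a common second endpoint reduces to a common first one. *)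
Lemma coverable_swap (T U : finType) (E : {set T * U}) s :
  coverable (swap_set E) s = coverable E s.
Proof.
apply/coverableP/coverableP=> -[A [B [sAB cov]]]; exists B, A;
  (split; first by rewrite addnC).
  by move=> [x y] Exy; rewrite orbC; apply: (cov (y, x)); rewrite inE.
by move=> [x y]; rewrite inE orbC => /cov.
Qed.

(* Covers (A1, B1), (A2, B2) missing e, f respectively both avoid the common
   endpoint u; then (A1 :|: A2 :|: u, B1 :&: B2) and (A1 :&: A2, B1 :|: B2)
   cover E, and their total size is at most 2s + 1. *)
Lemma coverable_fork (T U : finType) (E : {set T * U}) (e f : T * U) s :
  e \in E -> f \in E -> e != f -> e.1 = f.1 ->
  coverable (E :\ e) s -> coverable (E :\ f) s -> coverable E s.
Proof.
move=> Ee Ef nef ef1.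
move=> /coverableP[A1 [B1 [s1 cov1]]] /coverableP[A2 [B2 [s2 cov2]]].
apply/coverableP.
(* If the common endpoint lies in [A1], the first cover already covers [e], hence all of [E]. *)
have [eA1|eA1] := boolP (e.1 \in A1).
  exists A1, B1; split=> // p Ep; have [->|pe] := eqVneq p e; first by rewrite eA1.
  by apply: cov1; rewrite !inE pe.
have [fA2|fA2] := boolP (f.1 \in A2).
  exists A2, B2; split=> // p Ep; have [->|pf] := eqVneq p f; first by rewrite fA2.
  by apply: cov2; rewrite !inE pf.
have fB1 : f.2 \in B1.
  by have := cov1 f; rewrite !inE eq_sym nef Ef -ef1 (negPf eA1); apply.
have eB2 : e.2 \in B2.
  by have := cov2 e; rewrite !inE nef Ee ef1 (negPf fA2); apply.
have cov p : p \in E -> p != e -> p != f ->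
    ((p.1 \in A1) || (p.2 \in B1)) && ((p.1 \in A2) || (p.2 \in B2)).
  by move=> Ep pe pf; rewrite cov1 ?cov2 // !inE ?pe ?pf.
have cA := cardsUI A1 A2; have cB := cardsUI B1 B2.
have cU : #|e.1 |: (A1 :|: A2)| <= #|A1 :|: A2|.+1.
  by rewrite cardsU1; case: (_ \notin _).
(* The two sizes add up to at most 2s + 1, so one of them is at most s. *)
have [le|lt] := leqP (#|e.1 |: (A1 :|: A2)| + #|B1 :&: B2|) s.
  exists (e.1 |: (A1 :|: A2)), (B1 :&: B2); split=> // p Ep; rewrite !inE.
  have [->|pe] := eqVneq p e; first by rewrite eqxx.
  have [->|pf] := eqVneq p f; first by rewrite ef1 eqxx.
  have := cov p Ep pe pf.
  case: (p.1 \in A1) (p.1 \in A2) (p.2 \in B1) (p.2 \in B2) => [] [] [] [] //= _;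
    by rewrite ?orbT.
exists (A1 :&: A2), (B1 :|: B2); split; first lia.
move=> p Ep; rewrite !inE.
have [->|pe] := eqVneq p e; first by rewrite eB2 !orbT.
have [->|pf] := eqVneq p f; first by rewrite fB1 !orbT.
have := cov p Ep pe pf.
by case: (p.1 \in A1) (p.1 \in A2) (p.2 \in B1) (p.2 \in B2) => [] [] [] [].
Qed.

(* Lovasz's argument: an edge set minimal among those with no cover of size s
   is a matching. *)
Theorem koenig (T U : finType) (E : {set T * U}) s : ~~ coverable E s ->
  exists M : {set T * U}, [/\ M \subset E, s < #|M|,
    {in M &, injective (fun p => p.1)} & {in M &, injective (fun p => p.2)}].
Proof.
have [n] := ubnP #|E|; elim: n E => // n IHn E ltEn ncov.
have [/exists_inP[e Ee ncove]|] := boolP [exists e in E, ~~ coverable (E :\ e) s].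
  have [||M [ME sM M1 M2]] := IHn (E :\ e) => //.
    by move: ltEn; rewrite (cardsD1 e) Ee.
  by exists M; split=> //; apply: subset_trans ME (subsetDl _ _).
(* Now deleting any edge makes the set coverable, and [E] itself is the matching. *)
rewrite negb_exists_in => /forall_inP minE.
have {}minE e : e \in E -> coverable (E :\ e) s by move/minE; rewrite negbK.
exists E; split=> //.
(* At most s edges would be covered by their first endpoints. *)
- rewrite ltnNge; apply: contra ncov => leEs; apply/coverableP.
  exists [set p.1 | p in E], set0; rewrite cards0 addn0; split.
    exact: leq_trans (leq_imset_card _ _) leEs.
  by move=> p Ep; rewrite imset_f.
- move=> e f Ee Ef ef; apply/eqP/negPn; apply: contra ncov => nef.
  exact: (coverable_fork Ee Ef nef ef (minE e Ee) (minE f Ef)).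
move=> e f Ee Ef ef; apply/eqP/negPn; apply: contra ncov => nef.
have sw p : swap_set (E :\ p) = swap_set E :\ (p.2, p.1).
  apply/setP=> -[x y]; rewrite !inE /=; congr (~~ _ && _).
  by case: p => a b; rewrite !xpair_eqE andbC.
have swE p : p \in E -> (p.2, p.1) \in swap_set E by case: p => a b; rewrite inE.
have nef' : (e.2, e.1) != (f.2, f.1).
  by move: nef; case: (e) (f) => [a b] [c d]; rewrite !xpair_eqE andbC.
rewrite -coverable_swap; apply: (coverable_fork (swE e Ee) (swE f Ef) nef' ef).
  by rewrite -sw coverable_swap minE.
by rewrite -sw coverable_swap minE.
Qed.

(** * Counting edges by their endpoints *)

Lemma card_fibers (T U : finType) (f : T -> U) (E : {set T}) (A : {set U}) :
  {in E, forall p, f p \in A} ->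
  #|E| = \sum_(a in A) #|[set p in E | f p == a]|.
Proof.
move=> EA; rewrite -sum1_card (partition_big f (mem A)) //=.
by apply: eq_bigr => a _; rewrite -sum1dep_card.
Qed.

Lemma card_fibers_le (T U : finType) (f : T -> U) (E : {set T}) (A : {set U}) k :
  {in E, forall p, f p \in A} ->
  (forall a, #|[set p in E | f p == a]| <= k) -> #|E| <= k * #|A|.
Proof.
move=> EA fk; rewrite (card_fibers EA) mulnC -sum_nat_const.
exact: leq_sum.
Qed.

(** Each vertex of the cover accounts for at most k edges. *)
Lemma coverable_card (T U : finType) (E : {set T * U}) k s :
  (forall x, #|[set p in E | p.1 == x]| <= k) ->
  (forall y, #|[set p in E | p.2 == y]| <= k) ->
  coverable E s -> #|E| <= k * s.
Proof.
move=> k1 k2 /coverableP[A [B [sAB cov]]].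
apply: leq_trans (leq_mul (leqnn k) sAB); rewrite mulnDr.
have sE : E \subset [set p in E | p.1 \in A] :|: [set p in E | p.2 \in B].
  by apply/subsetP=> p Ep; rewrite !inE Ep cov.
apply: leq_trans (subset_leq_card sE) _; apply: leq_trans (leq_card_setU _ _) _.
apply: leq_add; [apply: (@card_fibers_le _ _ fst)|apply: (@card_fibers_le _ _ snd)].
- by move=> p; rewrite inE => /andP[].
- move=> a; apply: leq_trans (k1 a); apply/subset_leq_card/subsetP=> p.
  by rewrite !inE => /andP[/andP[-> _] ->].
- by move=> p; rewrite inE => /andP[].
- move=> a; apply: leq_trans (k2 a); apply/subset_leq_card/subsetP=> p.
  by rewrite !inE => /andP[/andP[-> _] ->].
Qed.

(** * Regular bipartite graphs and rainbow matchings as embeddings *)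

Lemma regular_card (G : sgraph) k (x : G) :
  regular G k -> #|[set y | sedge x y]| = k.
Proof. by move/forallP/(_ x)/eqP. Qed.

Lemma regular_fiber1_le (G : sgraph) k (E : {set G * G}) (x : G) :
  regular G k -> {in E, forall p, sedge p.1 p.2} ->
  #|[set p in E | p.1 == x]| <= k.
Proof.
move=> regG sE; rewrite -(regular_card x regG) -(@card_in_imset _ _ snd).
  apply/subset_leq_card/subsetP=> _ /imsetP[p + ->].
  by rewrite !inE => /andP[/sE + /eqP<-].
by move=> [a b] [c d]; rewrite !inE /= => /andP[_ /eqP->] /andP[_ /eqP->] ->.
Qed.

Lemma regular_fiber2_le (G : sgraph) k (E : {set G * G}) (y : G) :
  regular G k -> {in E, forall p, sedge p.1 p.2} ->
  #|[set p in E | p.2 == y]| <= k.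
Proof.
move=> regG sE; rewrite -(regular_card y regG) -(@card_in_imset _ _ fst).
  apply/subset_leq_card/subsetP=> _ /imsetP[p + ->].
  by rewrite !inE => /andP[/sE + /eqP<-]; rewrite sedge_sym.
by move=> [a b] [c d]; rewrite !inE /= => /andP[_ /eqP->] /andP[_ /eqP->] ->.
Qed.

Lemma bipartition_adj (G : sgraph) (X Y : {set G}) x y :
  bipartition X Y -> sedge x y -> (x \in X) && (y \in Y) || (x \in Y) && (y \in X).
Proof. by case/and3P=> _ _ /forallP/(_ x)/forallP/(_ y)/implyP. Qed.

Lemma bipartition_notin (G : sgraph) (X Y : {set G}) x :
  bipartition X Y -> x \in X -> x \in Y = false.
Proof. by case/and3P=> /pred0P/(_ x) /= H _ _ Xx; rewrite Xx in H. Qed.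

Lemma edges_bipartite (G : sgraph) (X Y : {set G}) e :
  bipartition X Y -> e \in edges G ->
  exists p : G * G,
    [/\ p.1 \in X, p.2 \in Y, sedge p.1 p.2 & e = [set p.1; p.2]].
Proof.
move=> bXY /imsetP[[x y] + ->]; rewrite inE /= => sxy.
case/orP: (bipartition_adj bXY sxy) => /andP[xX yY]; first by exists (x, y).
by exists (y, x); split; rewrite // 1?setUC // sedge_sym.
Qed.

Lemma mem_edges (G : sgraph) (x y : G) : sedge x y -> [set x; y] \in edges G.
Proof. by move=> sxy; apply/imsetP; exists (x, y); rewrite ?inE. Qed.

Lemma copy_edges_matchingP (G : sgraph) m (phi : {ffun matching_graph m -> G}) e :
  reflect (exists i : 'I_m, e = [set phi (i, false); phi (i, true)])
          (e \in copy_edges phi).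
Proof.
apply: (iffP imsetP) => [[_ /imsetP[[[i a] [j b]] + ->] ->]|[i ->]].
  rewrite inE => /andP[/eqP /= <- /= nab]; exists i.
  by rewrite imsetU1 imset_set1; case: a b nab => [] [] // _; rewrite // setUC.
exists [set ((i, false) : matching_graph m); ((i, true) : matching_graph m)];
  last by rewrite imsetU1 imset_set1.
by apply: mem_edges; rewrite /= /matching_rel eqxx.
Qed.

(** Endpoints on different sides never coincide, so injectivity on each side makes the map of
    vertices an embedding. *)
Lemma rainbow_matching_of_pairs (G : sgraph) (X Y : {set G}) r
    (c : {ffun {set G} -> 'I_r}) m (q : 'I_m -> G * G) :
  bipartition X Y ->
  (forall i, [/\ (q i).1 \in X, (q i).2 \in Y & sedge (q i).1 (q i).2]) ->
  injective (fun i => (q i).1) -> injective (fun i => (q i).2) ->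
  injective (fun i => c [set (q i).1; (q i).2]) ->
  has_rainbow_copy (matching_graph m) c.
Proof.
move=> bXY qP q1 q2 cq.
pose phi : {ffun matching_graph m -> G} :=
  [ffun v : matching_graph m => if v.2 then (q v.1).2 else (q v.1).1].
apply/existsP; exists phi; apply/andP; split; last first.
  apply/dinjectiveP => _ _ /copy_edges_matchingP[i ->] /copy_edges_matchingP[j ->].
  by rewrite !ffunE /= => /cq ->.
apply/andP; split.
  apply/injectiveP=> -[i a] [j b]; rewrite !ffunE /=.
  have [iX iY _] := qP i; have [jX jY _] := qP j.
  case: a; case: b => /= E; [by rewrite (q2 _ _ E)| | |by rewrite (q1 _ _ E)].
    by rewrite E (bipartition_notin bXY) in iY.
  by rewrite -E (bipartition_notin bXY) in jY.
apply/forallP=> -[i a]; apply/forallP=> -[j b]; apply/implyP.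
rewrite /= /matching_rel /= !ffunE /= => /andP[/eqP<-].
have [_ _ sq] := qP i.
by case: a b => [] [] // _; rewrite // sedge_sym.
Qed.

(** * The upper bound *)

Lemma rb_matching_le (G : sgraph) (X Y : {set G}) k m :
  bipartition X Y -> regular G k -> 0 < m ->
  rb G (matching_graph m) <= k * m.-1 + 1.
Proof.
move=> bXY regG m0; rewrite /rb; case: ex_minnP => r0 _; apply; rewrite addn1 /=.
apply/forallP=> c; apply/implyP=> /eqP colc.
have /eqP cT : c @: edges G == setT by rewrite eqEcard subsetT cardsT card_ord colc /=.
(* All colours occur, so each colour i has a representative edge [p i], oriented from [X] to [Y]. *)
have /fin_all_exists[p pP] (i : 'I_(k * m.-1).+1) : exists p : G * G,
    [/\ p.1 \in X, p.2 \in Y, sedge p.1 p.2 & c [set p.1; p.2] = i].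
  have : i \in c @: edges G by rewrite cT.
  case/imsetP=> e /(edges_bipartite bXY)[p [pX pY sp ->]] ->.
  by exists p.
have pK : cancel p (fun u => c [set u.1; u.2]) by move=> i; case: (pP i).
have cardE : #|[set p i | i in setT]| = (k * m.-1).+1.
  by rewrite card_imset ?cardsT ?card_ord //; apply: can_inj pK.
have sE : {in [set p i | i in setT], forall u : G * G, sedge u.1 u.2}.
  by move=> _ /imsetP[i _ ->]; case: (pP i).
(* A cover by m - 1 vertices would leave room for only k(m - 1) representatives. *)
have /koenig[M [ME sM M1 M2]] : ~~ coverable [set p i | i in setT] m.-1.
  apply/negP=> /(@coverable_card _ _ _ k).
  rewrite cardE ltnn => H; have : false; last by [].
  by apply: H => x; [apply: regular_fiber1_le | apply: regular_fiber2_le].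
have leM : m <= #|M| by rewrite -(prednK m0).
pose q (i : 'I_m) := enum_val (widen_ord leM i).
have qM i : q i \in M by apply: enum_valP.
have qp i : exists j, q i = p j.
  by have /imsetP[j _ ->] := subsetP ME _ (qM i); exists j.
have qinj : injective q by move=> i j /enum_val_inj [] /val_inj.
apply: (@rainbow_matching_of_pairs _ _ _ _ c m q bXY) => [i|i j|i j|i j].
- by have [j ->] := qp i; case: (pP j).
- by move=> E; apply: qinj; apply: M1.
- by move=> E; apply: qinj; apply: M2.
have [i' qi] := qp i; have [j' qj] := qp j; rewrite qi qj !pK => ij.
by apply: qinj; rewrite qi qj ij.
Qed.

(** * The extremal colouring and the lower bound *)

(* Extremal colouring: the edges meeting S receive the colours 0, ..., r - 1
   (the last one possibly repeated) and all the other edges the colour r. *)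
Lemma coloring_without_rainbow_matching (G : sgraph) (X Y : {set G}) k m r :
  bipartition X Y -> regular G k -> 0 < k -> m.+1 < #|X| -> r <= k * m ->
  exists2 c : {ffun {set G} -> 'I_r.+1},
    edge_coloring c & ~~ has_rainbow_copy (matching_graph m.+2) c.
Proof.
move=> bXY regG k0 ltm ler.
have /card_geqP[l [ul sl lX]] : m <= #|X| by lia.
pose S := [set x in l].
have cS : #|S| = m by rewrite cardsE (card_uniqP ul).
have SX : {subset S <= X} by move=> x; rewrite inE => /lX.
pose D := [set e in edges G | ~~ [disjoint e & S]].
(* Each of the m vertices of [S] has k edges; as [S] lies in [X], none is counted twice. *)
have cD : k * m <= #|D|.
  pose P := [set p : G * G | (p.1 \in S) && sedge p.1 p.2].
  have PY p : p \in P -> (p.1 \in X) && (p.2 \in Y).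
    rewrite inE => /andP[/SX pX /(bipartition_adj bXY)].
    by rewrite pX (bipartition_notin bXY pX) orbF.
  have -> : k * m = #|P|.
    rewrite (@card_fibers _ _ fst P S) => [|p]; last by rewrite inE => /andP[].
    rewrite -{1}cS mulnC -sum_nat_const; apply: eq_bigr => x xS.
    rewrite -(regular_card x regG) -(@card_imset _ _ (pair x)); last by move=> ? ? [].
    congr #|pred_of_set _|; apply/setP=> -[a b]; rewrite !inE /=.
    apply/imsetP/andP=> [[y + [-> ->]]|[/andP[_ sab] /eqP ax]].
      by rewrite inE => ->; rewrite eqxx andbT; move: xS; rewrite inE => ->.
    by exists b; rewrite -?ax // inE.
  have injP : {in P &, injective (fun p : G * G => [set p.1; p.2])}.
    move=> [a b] [a' b'] /PY /andP[/= aX bY] /PY /andP[/= aX' bY'] E.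
    have ne u v : u \in X -> v \in Y -> (u == v) = false.
      by move=> uX vY; apply/eqP=> uv; rewrite -uv (bipartition_notin bXY) in vY.
    have : a \in [set a'; b'] by rewrite -E !inE eqxx.
    have : b \in [set a'; b'] by rewrite -E !inE eqxx orbT.
    by rewrite !inE (ne a b') // [b == a']eq_sym ne // orbF => /eqP-> /eqP->.
  rewrite -(card_in_imset injP); apply/subset_leq_card/subsetP=> _ /imsetP[p + ->].
  rewrite inE => /andP[pS sp]; rewrite inE mem_edges //=.
  by apply/pred0Pn; exists p.1; rewrite /= !inE eqxx; move: pS; rewrite inE.
(* Outside [D] the index is the size of [D], at least r, and is cut down to r; edges of [D] with
   index at least r also get colour r. *)
pose c : {ffun {set G} -> 'I_r.+1} :=
  [ffun e : {set G} => inord (minn (index e (enum D)) r)].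
have cDE e : c e = minn (index e (enum D)) r :> nat.
  by rewrite ffunE inordK // ltnS geq_minr.
have cnD e : e \notin D -> c e = ord_max.
  move=> eD; apply: val_inj; rewrite /= cDE memNindex ?mem_enum // -cardE.
  exact/minn_idPr/(leq_trans ler).
exists c.
  rewrite /edge_coloring; suff -> : c @: edges G = setT by rewrite cardsT card_ord.
  apply/setP=> i; rewrite inE; apply/imsetP.
  have [ir|ri] := ltnP i r.
    have iD : i < size (enum D) by rewrite -cardE (leq_trans ir) ?(leq_trans ler).
    exists (nth set0 (enum D) i).
      by have := mem_nth set0 iD; rewrite mem_enum inE => /andP[].
    apply: val_inj; rewrite /= cDE index_uniq ?enum_uniq //; lia.
  (* Colour r occurs at an edge from a vertex of [X] outside [S]: its other end is in [Y], so it
     avoids [S]. *)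
  have [x xX xS] : exists2 x, x \in X & x \notin S.
    apply/subsetPn; apply/negP=> /subset_leq_card; rewrite cS; lia.
  have [y] : exists y, y \in [set y | sedge x y].
    by apply/card_gt0P; rewrite (regular_card x regG).
  rewrite inE => sxy; exists [set x; y]; first exact: mem_edges.
  rewrite cnD; first by apply: val_inj => /=; have := ltn_ord i; lia.
  rewrite inE negb_and negbK; apply/orP; right.
  have := bipartition_adj bXY sxy; rewrite xX (bipartition_notin bXY xX) orbF /= => yY.
  rewrite disjoint_subset; apply/subsetP=> z; rewrite !inE.
  case/orP=> /eqP ->; first by move: xS; rewrite inE.
  by apply/negP=> /lX yX; rewrite (bipartition_notin bXY yX) in yY.
apply/existsP=> -[phi /andP[/andP[/injectiveP phi_inj _] /dinjectiveP cinj]].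
pose e i := [set phi (i, false); phi (i, true)].
have eI i j x : x \in e i -> x \in e j -> i = j.
  rewrite !inE => /orP[] /eqP -> /orP[] /eqP /phi_inj; by case.
have eC i : e i \in copy_edges phi by apply/copy_edges_matchingP; exists i.
(* Each of the m + 2 matching edges goes to a vertex of [S] on it, or to [None]. Disjointness
   separates the former; at most one edge goes to [None], since all edges avoiding [S] share colour
   r. Hence m + 2 <= m + 1. *)
pose g i := [pick x | (x \in S) && (x \in e i)].
have g_inj : injective g.
  move=> i j; rewrite /g; case: pickP => [x /andP[_ xi]|Di].
    by case: pickP => // y /andP[_ yj] [xy]; apply: (@eI i j x); rewrite // xy.
  case: pickP => // Dj _.
  have nD h : (fun x => (x \in S) && (x \in e h)) =1 xpred0 -> e h \notin D.
    move=> Dh; rewrite inE negb_and negbK; apply/orP; right.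
    by apply/pred0P=> x; rewrite /= andbC Dh.
  have /(cinj _ _ (eC i) (eC j)) eij : c (e i) = c (e j).
    by rewrite !cnD ?nD.
  apply: (@eI i j (phi (i, false))); first by rewrite !inE eqxx.
  by rewrite -eij !inE eqxx.
have : #|g @: setT| <= #|None |: Some @: S|.
  apply/subset_leq_card/subsetP=> _ /imsetP[i _ ->]; rewrite /g.
  by case: pickP => [x /andP[xS _]|_]; rewrite !inE ?imset_f.
rewrite card_imset // cardsT card_ord cardsU1 card_imset ?cS; last by move=> ? ? [].
by case: (_ \notin _) => /=; lia.
Qed.

(** Were the rainbow number r + 1 with r <= km, the colouring with exactly r + 1 colours would
    contradict its forcing property. *)
Lemma rb_matching_ge (G : sgraph) (X Y : {set G}) k m :
  bipartition X Y -> regular G k -> 0 < k -> m.+1 < #|X| ->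
  k * m + 2 <= rb G (matching_graph m.+2).
Proof.
move=> bXY regG k0 ltm; rewrite /rb; case: ex_minnP => -[//|r] /andP[_ /forallP force] _.
rewrite addn2 !ltnS leqNgt; apply/negP=> /ltnSE ler.
have [c colc] := coloring_without_rainbow_matching bXY regG k0 ltm ler.
by move/implyP: (force c) => /(_ colc) ->.
Qed.

(** * Both bounds over the integers *)

Local Open Scope ring_scope.

Theorem theorem2p4 (n k m : nat) (hk : (1 <= k <= n)%N) (hm : (1 <= m <= n)%N)
    (B : sgraph) (X Y : {set B}) (hXY : bipartition X Y)
    (hX : #|X| = n) (hY : #|Y| = n) (hreg : regular B k) :
  k%:Z * (m%:Z - 2) + 2 <= (rb B (matching_graph m))%:Z
  /\ (rb B (matching_graph m))%:Z <= k%:Z * (m%:Z - 1) + 1.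
Proof.
case/andP: hk => k0 _; case: m hm => [//|m] /andP[_ mn]; split; last first.
  by have := rb_matching_le hXY hreg (ltn0Sn m); rewrite /=; nia.
case: m mn => [_|m mn]; last first.
  have := @rb_matching_ge B X Y k m hXY hreg k0; rewrite hX mn => /(_ isT); nia.
(* For m = 1 the lower bound reads 2 - k, at most 1, so positivity of [rb] suffices. *)
have : (0 < rb B (matching_graph 1))%N by rewrite /rb; case: ex_minnP => r /andP[].
nia.
Qed.
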